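(* Let $(\mathcal C,c)$ be a braided category. Let $\mathcal B(\mathcal C,c)$ be the category whose objects are pairs $(V,\eta_V)$ consisting of an object $V\in\mathcal C$ and an automorphism $\eta_V:V\to V$ in $\mathcal C$, and whose morphisms $(V,\eta_V)\to(W,\eta_W)$ are the morphisms $f:V\to W$ in $\mathcal C$ with $\eta_Wf=f\eta_V$. Then $\mathcal B(\mathcal C,c)$ is a balanced category via the following structure: (i) The tensor product is $(V,\eta_V)\otimes(W,\eta_W)=(V\otimes W,\eta_{V\otimes W})$ with $\eta_{V\otimes W}=(\eta_V\otimes\eta_W)c_{W,V}c_{V,W}$, and on morphisms it is the tensor product of $\mathcal C$; the unit object is $(\underline1,\eta_{\underline1}:=\mathrm{Id}_{\underline1})$; together with the associativity and the left and right unit constraints of $\mathcal C$ these give the monoidal structure. (ii) The braiding is determined by the braiding $c$ of $\mathcal C$. (iii) The balancing (twist) is $\eta:=(\eta_V)_{(V,\eta_V)\in\mathcal B(\mathcal C,c)}$.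
   Context: A braided category $(\mathcal C,c)$ is a monoidal category with a braiding $c=(c_{X,Y}:X\otimes Y\to Y\otimes X)$ (natural isomorphism satisfying the two hexagon axioms); $\underline1$ is the unit object. A braided category $(\mathcal C,c)$ is balanced if it is equipped with a natural isomorphism $\eta=(\eta_V:V\to V)_{V\in\mathcal C}$ of the identity functor (a twist) such that $\eta_{V\otimes W}=(\eta_V\otimes\eta_W)\circ c_{W,V}\circ c_{V,W}$ for all $V,W\in\mathcal C$. *)

(* Defs.v *)
From Stdlib Require Import ProofIrrelevance.

Set Implicit Arguments.
Unset Strict Implicit.
Unset Printing Implicit Defensive.

Declare Scope cat_scope.
Delimit Scope cat_scope with cat.
Local Open Scope cat_scope.

Reserved Notation "g \oc f" (at level 50, left associativity).

Record category : Type := Category {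
  ob :> Type;
  hom : ob -> ob -> Type;
  idm : forall X, hom X X;
  comp : forall X Y Z, hom Y Z -> hom X Y -> hom X Z;
  comp_idl : forall X Y (f : hom X Y), comp (idm Y) f = f;
  comp_idr : forall X Y (f : hom X Y), comp f (idm X) = f;
  comp_assoc : forall W X Y Z (h : hom Y Z) (g : hom X Y) (f : hom W X),
    comp h (comp g f) = comp (comp h g) f
}.

Arguments hom {c} _ _.
Arguments idm {c} _.
Arguments comp {c X Y Z} _ _.
Notation "g \oc f" := (comp g f) : cat_scope.

Record iso (C : category) (X Y : C) : Type := Iso {
  iso_hom :> hom X Y;
  iso_inv : hom Y X;
  iso_invl : iso_inv \oc iso_hom = idm X;
  iso_invr : iso_hom \oc iso_inv = idm Y
}.

(* The structures below are carried by a category C together with a fixed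
   tensor product T on objects and a fixed unit object I, so that a structure
   with prescribed T and I can be asserted without transporting morphisms
   along equalities of objects. *)

Record monoidal_structure (C : category) (T : C -> C -> C) (I : C) : Type :=
  MonoidalStructure {
  tensor : forall X X' Y Y' : C, hom X X' -> hom Y Y' -> hom (T X Y) (T X' Y');
  tensor_id : forall X Y : C, tensor (idm X) (idm Y) = idm (T X Y);
  tensor_comp : forall (X X' X'' Y Y' Y'' : C)
      (f' : hom X' X'') (f : hom X X') (g' : hom Y' Y'') (g : hom Y Y'),
    tensor (f' \oc f) (g' \oc g) = tensor f' g' \oc tensor f g;
  associator : forall X Y Z : C, iso (T (T X Y) Z) (T X (T Y Z));
  associator_natural : forall (X X' Y Y' Z Z' : C)
      (f : hom X X') (g : hom Y Y') (h : hom Z Z'),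
    associator X' Y' Z' \oc tensor (tensor f g) h
    = tensor f (tensor g h) \oc associator X Y Z;
  left_unitor : forall X : C, iso (T I X) X;
  left_unitor_natural : forall (X X' : C) (f : hom X X'),
    left_unitor X' \oc tensor (idm I) f = f \oc left_unitor X;
  right_unitor : forall X : C, iso (T X I) X;
  right_unitor_natural : forall (X X' : C) (f : hom X X'),
    right_unitor X' \oc tensor f (idm I) = f \oc right_unitor X;
  pentagon : forall W X Y Z : C,
    associator W X (T Y Z) \oc associator (T W X) Y Z
    = tensor (idm W) (associator X Y Z) \oc associator W (T X Y) Z
      \oc tensor (associator W X Y) (idm Z);
  triangle : forall X Y : C,
    tensor (idm X) (left_unitor Y) \oc associator X I Y
    = tensor (right_unitor X) (idm Y)
}.

Record braided_structure (C : category) (T : C -> C -> C) (I : C) : Type :=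
  BraidedStructure {
  braided_monoidal :> monoidal_structure T I;
  braiding : forall X Y : C, iso (T X Y) (T Y X);
  braiding_natural : forall (X X' Y Y' : C) (f : hom X X') (g : hom Y Y'),
    braiding X' Y' \oc tensor braided_monoidal f g
    = tensor braided_monoidal g f \oc braiding X Y;
  hexagon_right : forall X Y Z : C,
    associator braided_monoidal Y Z X \oc braiding X (T Y Z)
      \oc associator braided_monoidal X Y Z
    = tensor braided_monoidal (idm Y) (braiding X Z)
      \oc associator braided_monoidal Y X Z
      \oc tensor braided_monoidal (braiding X Y) (idm Z);
  hexagon_left : forall X Y Z : C,
    iso_inv (associator braided_monoidal Z X Y) \oc braiding (T X Y) Z
      \oc iso_inv (associator braided_monoidal X Y Z)
    = tensor braided_monoidal (braiding X Z) (idm Y)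
      \oc iso_inv (associator braided_monoidal X Z Y)
      \oc tensor braided_monoidal (idm X) (braiding Y Z)
}.

Record balanced_structure (C : category) (T : C -> C -> C) (I : C) : Type :=
  BalancedStructure {
  balanced_braided :> braided_structure T I;
  twist : forall V : C, iso V V;
  twist_natural : forall (V W : C) (f : hom V W),
    twist W \oc f = f \oc twist V;
  twist_tensor : forall V W : C,
    iso_hom (twist (T V W))
    = tensor balanced_braided (twist V) (twist W)
      \oc braiding balanced_braided W V \oc braiding balanced_braided V W
}.

Definition iso_id (C : category) (X : C) : iso X X :=
  Iso (comp_idl (idm X)) (comp_idl (idm X)).

Lemma comp_cancel (C : category) (X Y Z : C)
    (g : hom Y Z) (g' : hom Z Y) (f : hom X Y) (f' : hom Y X) :
  g' \oc g = idm Y -> f' \oc f = idm X -> (f' \oc g') \oc (g \oc f) = idm X.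
Proof.
intros Hg Hf.
now rewrite comp_assoc, <- (comp_assoc f' g' g), Hg, comp_idr.
Qed.

Definition iso_comp (C : category) (X Y Z : C) (g : iso Y Z) (f : iso X Y) :
    iso X Z :=
  Iso (comp_cancel (iso_invl g) (iso_invl f))
      (comp_cancel (iso_invr f) (iso_invr g)).

Lemma tensor_cancel (C : category) (T : C -> C -> C) (I : C)
    (M : monoidal_structure T I) (X X' Y Y' : C)
    (f : hom X X') (f' : hom X' X) (g : hom Y Y') (g' : hom Y' Y) :
  f' \oc f = idm X -> g' \oc g = idm Y ->
  tensor M f' g' \oc tensor M f g = idm (T X Y).
Proof. now intros Hf Hg; rewrite <- tensor_comp, Hf, Hg, tensor_id. Qed.

Definition iso_tensor (C : category) (T : C -> C -> C) (I : C)
    (M : monoidal_structure T I) (X X' Y Y' : C)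
    (f : iso X X') (g : iso Y Y') : iso (T X Y) (T X' Y') :=
  Iso (tensor_cancel M (iso_invl f) (iso_invl g))
      (tensor_cancel M (iso_invr f) (iso_invr g)).

(* The inverse stored in [aut_eta] is determined by its [iso_hom], so an object
   amounts to a pair (V, eta_V) with eta_V invertible. *)
Record aut_ob (C : category) : Type := AutOb {
  aut_carrier : C;
  aut_eta : iso aut_carrier aut_carrier
}.

Record aut_hom (C : category) (V W : aut_ob C) : Type := AutHom {
  aut_fun :> hom (aut_carrier V) (aut_carrier W);
  aut_comm : aut_eta W \oc aut_fun = aut_fun \oc aut_eta V
}.

Lemma aut_hom_eq (C : category) (V W : aut_ob C) (f g : aut_hom V W) :
  aut_fun f = aut_fun g -> f = g.
Proof.
destruct f as [f Hf], g as [g Hg]; simpl; intros E; subst g.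
now rewrite (proof_irrelevance _ Hf Hg).
Qed.

Definition aut_idm (C : category) (V : aut_ob C) : aut_hom V V.
Proof.
refine (@AutHom C V V (idm (aut_carrier V)) _).
now rewrite comp_idl, comp_idr.
Defined.

Definition aut_comp (C : category) (U V W : aut_ob C)
    (g : aut_hom V W) (f : aut_hom U V) : aut_hom U W.
Proof.
refine (@AutHom C U W (aut_fun g \oc aut_fun f) _).
now rewrite comp_assoc, aut_comm, <- comp_assoc, aut_comm, comp_assoc.
Defined.

Definition aut_category (C : category) : category.
Proof.
refine (@Category (aut_ob C) (@aut_hom C) (@aut_idm C) (@aut_comp C) _ _ _);
  intros; apply aut_hom_eq; simpl.
- apply comp_idl.
- apply comp_idr.
- apply comp_assoc.
Defined.

Definition aut_tensor (C : category) (T : C -> C -> C) (I : C)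
    (c : braided_structure T I) (V W : aut_category C) : aut_category C :=
  AutOb (iso_comp (iso_comp (iso_tensor c (aut_eta V) (aut_eta W))
                            (braiding c (aut_carrier W) (aut_carrier V)))
                  (braiding c (aut_carrier V) (aut_carrier W))).

Definition aut_unit (C : category) (I : C) : aut_category C :=
  AutOb (iso_id I).

Definition aut_hom_fun (C : category) (V W : aut_category C) (f : hom V W) :
    hom (aut_carrier V) (aut_carrier W) :=
  aut_fun f.

(* Main.v *)
Require Import Defs.

Set Implicit Arguments.
Unset Strict Implicit.
Unset Printing Implicit Defensive.

Local Open Scope cat_scope.

(** The pairs (V, eta_V) inherit everything from the braided category C as
    soon as the structural morphisms of C commute with the prescribed
    automorphisms: the axioms are equations in C, which hold there already.

    For tensor products of morphisms and for the braiding this commutation is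
    the naturality of c, and the twist law is the very definition of the tensor
    product of pairs.  The content lies in the constraints.  With
    D_{X,Y} = c_{Y,X} c_{X,Y}, they amount to the identities

      - a (D_{U,V} (x) W) D_{U(x)V,W} = (U (x) D_{V,W}) D_{U,V(x)W} a
        for the associator a.  Both sides are the full twist on three strands,
        i.e. the square of a half twist, and [half_twist] expresses the half
        twist in the two ways in which it can be built from braidings of a
        strand with a pair of strands ([full_twist]).

      - D_{1,X} = D_{X,1} = id for the unitors.  The first hexagon gives
        l_X c_{X,1} = r_X ([left_unitor_braiding], by way of Kelly's identity
        [left_unitor_tensor]).  The inverse braiding is a braiding as well, so
        the same statement for it says that c_{1,X} is inverse to c_{X,1}. *)

(** * Isomorphisms and composition *)

Lemma comp_whisker (C : category) (W X Y Y' Z : C)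
    (g : hom Y Z) (f : hom X Y) (g' : hom Y' Z) (f' : hom X Y') (h : hom W X) :
  g \oc f = g' \oc f' -> g \oc (f \oc h) = g' \oc (f' \oc h).
Proof. now intros E; rewrite !comp_assoc, E. Qed.

Lemma iso_cancel_left (C : category) (X Y Z : C) (p : iso Y Z)
    (f g : hom X Y) :
  p \oc f = p \oc g -> f = g.
Proof.
intros E; rewrite <- (comp_idl f), <- (comp_idl g), <- (iso_invl p).
now rewrite <- !comp_assoc, E.
Qed.

Lemma iso_cancel_right (C : category) (X Y Z : C) (p : iso X Y)
    (f g : hom Y Z) :
  f \oc p = g \oc p -> f = g.
Proof.
intros E; rewrite <- (comp_idr f), <- (comp_idr g), <- (iso_invr p).
now rewrite !comp_assoc, E.
Qed.

Lemma iso_inv_unique (C : category) (X Y : C) (p q : iso X Y) :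
  iso_hom p = iso_hom q -> iso_inv p = iso_inv q.
Proof.
intros E; apply (iso_cancel_right (p := p)).
now rewrite iso_invl, E, iso_invl.
Qed.

Definition iso_sym (C : category) (X Y : C) (p : iso X Y) : iso Y X :=
  Iso (iso_invr p) (iso_invl p).

(** * Monoidal identities *)

Section Monoidal.

Variables (C : category) (T : C -> C -> C) (I : C).
Variable M : monoidal_structure T I.

Notation a := (associator M).
Notation l := (left_unitor M).
Notation r := (right_unitor M).

Lemma tensor_comp_left (X X' X'' Y Y' : C)
    (f' : hom X' X'') (f : hom X X') (g : hom Y Y') :
  tensor M (f' \oc f) g = tensor M f' g \oc tensor M f (idm Y).
Proof. now rewrite <- tensor_comp, comp_idr. Qed.

Lemma tensor_comp_right (X X' Y Y' Y'' : C)
    (f : hom X X') (g' : hom Y' Y'') (g : hom Y Y') :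
  tensor M f (g' \oc g) = tensor M f g' \oc tensor M (idm X) g.
Proof. now rewrite <- tensor_comp, comp_idr. Qed.

(** Naturality of the left unitor exhibits the functor that tensors with the
    unit as isomorphic to the identity functor. *)
Lemma tensor_unit_faithful (X Y : C) (f g : hom X Y) :
  tensor M (idm I) f = tensor M (idm I) g -> f = g.
Proof.
intros E; apply (iso_cancel_right (p := l X)).
now rewrite <- !left_unitor_natural, E.
Qed.

Lemma tensor_faithful_unit (X Y : C) (f g : hom X Y) :
  tensor M f (idm I) = tensor M g (idm I) -> f = g.
Proof.
intros E; apply (iso_cancel_right (p := r X)).
now rewrite <- !right_unitor_natural, E.
Qed.

(** Kelly's identity.  After tensoring with the unit on the left, both sides
    become composites along the pentagon for 1, 1, X, Y, where the triangle
    axiom and the naturality of the associator identify them. *)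
Lemma left_unitor_tensor (X Y : C) :
  l (T X Y) \oc a I X Y = tensor M (l X) (idm Y).
Proof.
apply tensor_unit_faithful.
apply (iso_cancel_right (p := a I (T I X) Y)).
apply (iso_cancel_right (p := iso_tensor M (a I I X) (iso_id Y))); simpl.
rewrite tensor_comp_right, <- !comp_assoc.
rewrite (comp_assoc (tensor M (idm I) (a I X Y))), <- pentagon.
rewrite comp_assoc, triangle.
rewrite <- (tensor_id M X Y), <- associator_natural.
rewrite <- (triangle M I X), tensor_comp_left.
now rewrite !comp_assoc, associator_natural.
Qed.

End Monoidal.

(** * The double braiding *)

Section Braided.

Variables (C : category) (T : C -> C -> C) (I : C).

(** The inverse braiding exchanges the roles of the two hexagons: each one is
    the inverse of the other, up to renaming the objects. *)
Definition reverse_braiding (c : braided_structure T I) :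
  braided_structure T I.
Proof.
refine (@BraidedStructure C T I c
          (fun X Y => iso_sym (braiding c Y X)) _ _ _); simpl.
- intros X X' Y Y' f g.
  apply (iso_cancel_left (p := braiding c Y' X')).
  apply (iso_cancel_right (p := braiding c Y X)).
  rewrite <- !comp_assoc, iso_invl, comp_idr.
  now rewrite !comp_assoc, iso_invr, comp_idl, braiding_natural.
- intros X Y Z.
  rewrite <- !comp_assoc.
  apply (@iso_inv_unique _ _ _
    (iso_comp (iso_comp (iso_sym (associator c X Y Z))
                        (braiding c (T Y Z) X))
              (iso_sym (associator c Y Z X)))
    (iso_comp (iso_comp (iso_tensor c (braiding c Y X) (iso_id Z))
                        (iso_sym (associator c Y X Z)))
              (iso_tensor c (iso_id Y) (braiding c Z X)))).
  apply hexagon_left.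
- intros X Y Z.
  rewrite <- !comp_assoc.
  apply (@iso_inv_unique _ _ _
    (iso_comp (iso_comp (associator c X Y Z) (braiding c Z (T X Y)))
              (associator c Z X Y))
    (iso_comp (iso_comp (iso_tensor c (iso_id X) (braiding c Z Y))
                        (associator c X Z Y))
              (iso_tensor c (braiding c Z X) (iso_id Y)))).
  apply hexagon_right.
Defined.

(** The hexagon for X, 1, Z, followed by the left unitor of Z (x) X, reads
    c_{X,Z} (r_X (x) Z) = c_{X,Z} (l_X c_{X,1} (x) Z).
    The case Z = 1 suffices, because tensoring with 1 is faithful. *)
Lemma left_unitor_braiding (c : braided_structure T I) (X : C) :
  left_unitor c X \oc braiding c X I = right_unitor c X.
Proof.
apply (tensor_faithful_unit (M := c)).
apply (iso_cancel_left (p := braiding c X I)).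
rewrite tensor_comp_left, <- left_unitor_tensor, <- triangle.
rewrite !comp_assoc, <- left_unitor_natural, braiding_natural.
rewrite <- left_unitor_tensor, <- !comp_assoc.
f_equal.
rewrite !comp_assoc; symmetry; apply hexagon_right.
Qed.

Variable c : braided_structure T I.

Notation a := (associator c).
Notation b := (braiding c).

Definition double_braiding (X Y : C) : hom (T X Y) (T X Y) :=
  b Y X \oc b X Y.

Lemma double_braiding_natural (X X' Y Y' : C) (f : hom X X') (g : hom Y Y') :
  double_braiding X' Y' \oc tensor c f g
  = tensor c f g \oc double_braiding X Y.
Proof.
unfold double_braiding.
now rewrite <- comp_assoc, braiding_natural, !comp_assoc, braiding_natural.
Qed.

Lemma double_braiding_unit_left (X : C) : double_braiding I X = idm (T I X).
Proof.
apply (iso_cancel_left (p := left_unitor c X)); unfold double_braiding.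
rewrite comp_assoc, left_unitor_braiding.
rewrite <- (left_unitor_braiding (reverse_braiding c)); simpl.
now rewrite <- comp_assoc, iso_invl.
Qed.

Lemma double_braiding_unit_right (X : C) : double_braiding X I = idm (T X I).
Proof.
apply (iso_cancel_left (p := b X I)); unfold double_braiding.
rewrite comp_assoc.
fold (double_braiding I X).
now rewrite double_braiding_unit_left, comp_idl, comp_idr.
Qed.

(** Up to associators, the half twist on three strands may be formed by first
    reversing V, W and then moving U past them, or by first moving W past U, V
    and then reversing those; one hexagon of each kind reduces both to the
    same product of three crossings. *)
Lemma half_twist (U V W : C) :
  a W V U \oc (b U (T W V) \oc (tensor c (idm U) (b V W) \oc a U V W))
  = tensor c (idm W) (b U V) \oc b (T U V) W.
Proof.
(* The first hexagon for U, W, V, solved for its outer braiding. *)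
assert (R : a W V U \oc b U (T W V)
            = tensor c (idm W) (b U V) \oc a W U V
              \oc tensor c (b U W) (idm V) \oc iso_inv (a U W V)).
{ rewrite <- hexagon_right, <- comp_assoc.
  now rewrite iso_invr, comp_idr. }
rewrite comp_assoc, R, <- !comp_assoc.
rewrite (comp_assoc (iso_inv (a U W V))).
rewrite !(comp_assoc (tensor c (b U W) (idm V))), <- hexagon_left.
rewrite <- !comp_assoc, iso_invl, comp_idr.
now rewrite (comp_assoc (a W U V)), iso_invr, comp_idl.
Qed.

(** Both sides are the composite of the half twist on U, V, W and the half
    twist on W, V, U. *)
Lemma full_twist (U V W : C) :
  a U V W \oc (tensor c (double_braiding U V) (idm W)
               \oc double_braiding (T U V) W)
  = tensor c (idm U) (double_braiding V W)
    \oc (double_braiding U (T V W) \oc a U V W).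
Proof.
unfold double_braiding.
rewrite tensor_comp_left, tensor_comp_right, <- !comp_assoc.
rewrite (comp_whisker (b (T U V) W) (eq_sym (braiding_natural c _ _))).
rewrite <- half_twist.
(* The half twist on W, V, U, with its crossing of V and U moved past the
   braiding with W by naturality. *)
assert (H : a U V W \oc (tensor c (b V U) (idm W)
              \oc (b W (T V U) \oc a W V U))
            = tensor c (idm U) (b W V) \oc b (T W V) U).
{ rewrite <- half_twist.
  now rewrite (comp_whisker _ (braiding_natural c _ _)). }
rewrite !comp_assoc in H.
rewrite !comp_assoc, H, <- !comp_assoc; f_equal.
rewrite (comp_whisker _ (braiding_natural c _ _)).
now rewrite (comp_whisker _ (braiding_natural c _ _)).
Qed.

End Braided.

(** * The balanced structure *)

Lemma aut_inv_comm (C : category) (V W : aut_category C)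
    (p : iso (aut_carrier V) (aut_carrier W)) :
  aut_eta W \oc p = p \oc aut_eta V ->
  aut_eta V \oc iso_inv p = iso_inv p \oc aut_eta W.
Proof.
intros E; apply (iso_cancel_left (p := p)), (iso_cancel_right (p := p)).
rewrite <- !comp_assoc, iso_invl, comp_idr, <- E.
now rewrite (comp_assoc p), iso_invr, comp_idl.
Qed.

Definition aut_iso (C : category) (V W : aut_category C)
    (p : iso (aut_carrier V) (aut_carrier W))
    (E : aut_eta W \oc p = p \oc aut_eta V) : iso V W.
Proof.
refine (@Iso (aut_category C) V W (AutHom E) (AutHom (aut_inv_comm E)) _ _);
  apply aut_hom_eq; simpl.
- apply iso_invl.
- apply iso_invr.
Defined.

Section Balanced.

Variables (C : category) (T : C -> C -> C) (I : C).
Variable c : braided_structure T I.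

Lemma aut_eta_tensor (V W : aut_category C) :
  iso_hom (aut_eta (aut_tensor c V W))
  = tensor c (aut_eta V) (aut_eta W)
    \oc double_braiding c (aut_carrier V) (aut_carrier W).
Proof. symmetry; apply comp_assoc. Qed.

Lemma aut_tensor_comm (V V' W W' : aut_category C)
    (f : hom V V') (g : hom W W') :
  aut_eta (aut_tensor c V' W') \oc tensor c (aut_fun f) (aut_fun g)
  = tensor c (aut_fun f) (aut_fun g) \oc aut_eta (aut_tensor c V W).
Proof.
rewrite !aut_eta_tensor, <- comp_assoc, double_braiding_natural.
now rewrite !comp_assoc, <- !tensor_comp, !aut_comm.
Qed.

Lemma aut_associator_comm (U V W : aut_category C) :
  aut_eta (aut_tensor c U (aut_tensor c V W))
    \oc associator c (aut_carrier U) (aut_carrier V) (aut_carrier W)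
  = associator c (aut_carrier U) (aut_carrier V) (aut_carrier W)
    \oc aut_eta (aut_tensor c (aut_tensor c U V) W).
Proof.
rewrite !(aut_eta_tensor U), !(aut_eta_tensor _ W), (aut_eta_tensor U V).
rewrite tensor_comp_left, tensor_comp_right, <- !comp_assoc, <- full_twist.
now rewrite !comp_assoc, associator_natural.
Qed.

Lemma aut_left_unitor_comm (V : aut_category C) :
  aut_eta V \oc left_unitor c (aut_carrier V)
  = left_unitor c (aut_carrier V)
    \oc aut_eta (aut_tensor c (aut_unit I) V).
Proof.
rewrite aut_eta_tensor; simpl.
now rewrite double_braiding_unit_left, comp_idr, left_unitor_natural.
Qed.

Lemma aut_right_unitor_comm (V : aut_category C) :
  aut_eta V \oc right_unitor c (aut_carrier V)
  = right_unitor c (aut_carrier V)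
    \oc aut_eta (aut_tensor c V (aut_unit I)).
Proof.
rewrite aut_eta_tensor; simpl.
now rewrite double_braiding_unit_right, comp_idr, right_unitor_natural.
Qed.

Lemma aut_braiding_comm (V W : aut_category C) :
  aut_eta (aut_tensor c W V) \oc braiding c (aut_carrier V) (aut_carrier W)
  = braiding c (aut_carrier V) (aut_carrier W)
    \oc aut_eta (aut_tensor c V W).
Proof.
simpl; now rewrite !comp_assoc, braiding_natural.
Qed.

Definition aut_tensor_hom (V V' W W' : aut_category C)
    (f : hom V V') (g : hom W W') :
    hom (aut_tensor c V W) (aut_tensor c V' W') :=
  @AutHom C (aut_tensor c V W) (aut_tensor c V' W') _ (aut_tensor_comm f g).

Definition aut_associator (U V W : aut_category C) :
    iso (aut_tensor c (aut_tensor c U V) W)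
        (aut_tensor c U (aut_tensor c V W)) :=
  @aut_iso C (aut_tensor c (aut_tensor c U V) W)
    (aut_tensor c U (aut_tensor c V W)) _ (aut_associator_comm U V W).

Definition aut_left_unitor (V : aut_category C) :
    iso (aut_tensor c (aut_unit I) V) V :=
  @aut_iso C (aut_tensor c (aut_unit I) V) V _ (aut_left_unitor_comm V).

Definition aut_right_unitor (V : aut_category C) :
    iso (aut_tensor c V (aut_unit I)) V :=
  @aut_iso C (aut_tensor c V (aut_unit I)) V _ (aut_right_unitor_comm V).

Definition aut_braiding (V W : aut_category C) :
    iso (aut_tensor c V W) (aut_tensor c W V) :=
  @aut_iso C (aut_tensor c V W) (aut_tensor c W V) _ (aut_braiding_comm V W).

Definition aut_twist (V : aut_category C) : iso V V :=
  @aut_iso C V V (aut_eta V) eq_refl.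

Definition aut_monoidal :
  monoidal_structure (aut_tensor c) (aut_unit I).
Proof.
refine (@MonoidalStructure (aut_category C) (aut_tensor c) (aut_unit I)
  aut_tensor_hom _ _ aut_associator _ aut_left_unitor _
  aut_right_unitor _ _ _);
  intros; apply aut_hom_eq; simpl.
- apply tensor_id.
- apply tensor_comp.
- apply associator_natural.
- apply left_unitor_natural.
- apply right_unitor_natural.
- apply pentagon.
- apply triangle.
Defined.

Definition aut_braided : braided_structure (aut_tensor c) (aut_unit I).
Proof.
refine (@BraidedStructure (aut_category C) (aut_tensor c) (aut_unit I)
  aut_monoidal aut_braiding _ _ _);
  intros; apply aut_hom_eq; simpl.
- apply braiding_natural.
- apply hexagon_right.
- apply hexagon_left.
Defined.

Definition aut_balanced : balanced_structure (aut_tensor c) (aut_unit I).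
Proof.
refine (@BalancedStructure (aut_category C) (aut_tensor c) (aut_unit I)
  aut_braided aut_twist _ _);
  intros; apply aut_hom_eq; simpl.
- apply aut_comm.
- reflexivity.
Defined.

End Balanced.

Theorem proposition4p1 (C : category) (T : C -> C -> C) (I : C)
    (c : braided_structure T I) :
  exists B : balanced_structure (aut_tensor c) (aut_unit I),
    (forall V W : aut_category C,
       iso_hom (aut_eta (aut_tensor c V W))
       = tensor c (aut_eta V) (aut_eta W)
         \oc braiding c (aut_carrier W) (aut_carrier V)
         \oc braiding c (aut_carrier V) (aut_carrier W)) /\
    iso_hom (aut_eta (aut_unit I)) = idm I /\
    (forall (V V' W W' : aut_category C) (f : hom V V') (g : hom W W'),
       aut_hom_fun (tensor B f g) = tensor c (aut_hom_fun f) (aut_hom_fun g)) /\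
    (forall U V W : aut_category C,
       aut_hom_fun (associator B U V W)
       = associator c (aut_carrier U) (aut_carrier V) (aut_carrier W)) /\
    (forall V : aut_category C,
       aut_hom_fun (left_unitor B V) = left_unitor c (aut_carrier V)) /\
    (forall V : aut_category C,
       aut_hom_fun (right_unitor B V) = right_unitor c (aut_carrier V)) /\
    (forall V W : aut_category C,
       aut_hom_fun (braiding B V W)
       = braiding c (aut_carrier V) (aut_carrier W)) /\
    (forall V : aut_category C, aut_hom_fun (twist B V) = aut_eta V).
Proof.
now exists (aut_balanced c); repeat split.
Qed.
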